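(* Let $x_1,\dots,x_n\in\mathbb R$ with $x_1^2+\cdots+x_n^2=1$, let $\epsilon_1,\dots,\epsilon_n$ be i.i.d. random variables with $\mathbf P(\epsilon_i=1)=\mathbf P(\epsilon_i=-1)=\frac12$, and let $S_n=\epsilon_1x_1+\cdots+\epsilon_nx_n$. Then for all $x>0$ $$\mathbf P(S_n\ge x)<\frac{2e^3}{9}\bigl(1-\Phi(x)\bigr)<\frac{2e^3}{9}\,\frac{\varphi(x)}{x}.$$
   Context: $\varphi(x)=(2\pi)^{-1/2}e^{-x^2/2}$ and $\Phi(x)=\int_{-\infty}^x\varphi(u)\,du$ are the standard normal density and distribution function. *)

(* Defs.v *)
From mathcomp Require Import all_boot all_order all_algebra.
From mathcomp Require Import all_classical all_reals all_analysis.

Set Implicit Arguments.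
Unset Strict Implicit.
Unset Printing Implicit Defensive.

Import Order.TTheory GRing.Theory Num.Theory.
Import numFieldNormedType.Exports.

Local Open Scope classical_set_scope.
Local Open Scope ring_scope.

Definition std_normal_pdf (R : realType) (x : R) : R := normal_pdf 0 1 x.

Definition std_normal_cdf (R : realType) (x : R) : R :=
  (\int[lebesgue_measure]_(u in `]-oo, x]) std_normal_pdf u)%R.

Lemma std_normal_pdfE (R : realType) (x : R) :
  std_normal_pdf x = (Num.sqrt (2 * pi))^-1 * expR (- (x ^+ 2 / 2)).
Proof.
rewrite /std_normal_pdf normal_pdfE ?oner_neq0// /normal_peak /normal_fun.
by rewrite expr1n mul1r subr0 mulr_natl mulNr.
Qed.

Lemma EFin_std_normal_cdf (R : realType) (x : R) :
  (std_normal_cdf x)%:E = normal_prob 0 1 `]-oo, x].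
Proof.
rewrite /std_normal_cdf /Rintegral fineK//.
exact: (fin_num_measure (normal_prob (0 : R) 1)).
Qed.

(* Every finite subfamily is covered: [I] is finite and [J] is any subset. *)
Definition mutually_independent d (T : measurableType d) d'
    (T' : measurableType d') (R : realType) (P : probability T R)
    (I : finType) (X : I -> {RV P >-> T'}) : Prop :=
  forall (J : {set I}) (A : I -> set T'),
    (forall i, i \in J -> measurable (A i)) ->
    P (\bigcap_(i in [set` J]) (X i @^-1` A i)) =
    (\prod_(i in J) P (X i @^-1` A i))%E.

Definition rademacher d (T : measurableType d) (R : realType)
    (P : probability T R) (X : {RV P >-> R}) : Prop :=
  P [set w | X w = 1] = (2^-1)%:E /\ P [set w | X w = -1] = (2^-1)%:E.

(* Main.v *)
Require Import Defs.
From HB Require Import structures.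
From mathcomp Require Import all_boot all_order all_algebra.
From mathcomp Require Import all_classical all_reals all_analysis.
From mathcomp Require Import measurable_realfun ring lra.

Set Implicit Arguments.
Unset Strict Implicit.
Unset Printing Implicit Defensive.

Import Order.TTheory GRing.Theory Num.Theory.
Import numFieldNormedType.Exports.

Local Open Scope classical_set_scope.
Local Open Scope ring_scope.

(** Write c = 2 e^3 / 9, Q = 1 - Phi for the normal tail and phi for the normal
density.  The second inequality is the classical bound Q t < phi t / t
([normal_tail_lt]).  The first one is proved by induction on the number of
summands, in the form P (S >= t) < c Q (t / sqrt V), where V is the sum of the
squared weights and t > 0; put x = t / sqrt V.

If x^2 <= 3, two crude bounds suffice.  By symmetry, P (S >= t) is half of
P (|S| >= t), hence at most 1/2 and, by Chebyshev's inequality, at most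
1 / (2 x^2).  On (0, sqrt 3] the smaller of the two is below c Q x
([min_half_chebyshev_lt]): c Q x - 1 / (2 x^2) decreases on [1, sqrt 3], so
everything reduces to c Q (sqrt 3) > 1/6, which follows from the lower bound
Q y > phi y * y / (1 + y^2) ([normal_tail_gt]) and from e^3 > 6 pi.

If x^2 >= 3, condition on the first sign.  With a the first weight and
tau = a / sqrt V, the induction hypothesis bounds P (S >= t) by the mean of
c Q ((x - tau) / sqrt (1 - tau^2)) and c Q ((x + tau) / sqrt (1 - tau^2)),
and this mean is at most c Q x ([normal_tail_midpoint]).  The last fact is
where sqrt 3 comes from: to leading order in tau, the mean of the two values
of Q minus Q x is - (tau^4 / 12) (x^3 - 3 x) phi x.  For all tau in [0, 1) the
derivative in tau has the right sign by an inequality for the inverse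
hyperbolic tangent ([expR_artanh_le]).

The induction is carried out for the explicit average over all sign patterns
([sign_tail]); independence enters in [prob_frozen_signs_tail], where the signs
are revealed one at a time to bound the probability by that average. *)

(** * Monotonicity from derivatives *)

Lemma is_derive_within_continuous (R : realType) (f df : R -> R) (a b : R) :
  (forall x, a <= x <= b -> is_derive x 1 f (df x)) ->
  {within `[a, b], continuous f}.
Proof.
move=> fdf; apply: derivable_within_continuous => x.
by rewrite in_itv/= => /fdf[].
Qed.

Lemma is_derive_ge0_le (R : realType) (f df : R -> R) (a b : R) : a <= b ->
  (forall x, a <= x <= b -> is_derive x 1 f (df x)) ->
  (forall x, a < x < b -> 0 <= df x) -> f a <= f b.
Proof.
rewrite le_eqVlt => /predU1P[-> //|ab] fdf df0.
have fdf' x : x \in `]a, b[ -> is_derive x 1 f (df x).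
  by rewrite in_itv/= => /andP[ax xb]; apply: fdf; rewrite !ltW.
have [c cab fab] := MVT ab fdf' (is_derive_within_continuous fdf).
by rewrite -subr_ge0 fab mulr_ge0 ?subr_ge0 ?(ltW ab)// df0.
Qed.

Lemma is_derive_gt0_lt (R : realType) (f df : R -> R) (a b : R) : a < b ->
  (forall x, a <= x <= b -> is_derive x 1 f (df x)) ->
  (forall x, a < x < b -> 0 < df x) -> f a < f b.
Proof.
move=> ab fdf df0.
have fdf' x : x \in `]a, b[ -> is_derive x 1 f (df x).
  by rewrite in_itv/= => /andP[ax xb]; apply: fdf; rewrite !ltW.
have [c cab fab] := MVT ab fdf' (is_derive_within_continuous fdf).
by rewrite -subr_gt0 fab mulr_gt0 ?subr_gt0// df0.
Qed.

(** A strictly decreasing function whose lower limit at infinity is nonnegative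
is positive: it lies strictly above its value one unit further, which is
nonnegative. *)
Lemma decreasing_to_ge0_gt0 (R : realType) (f df : R -> R) (a : R) :
  (forall x, a <= x -> is_derive x 1 f (df x)) ->
  (forall x, a < x -> df x < 0) ->
  (forall e, 0 < e -> \forall x \near +oo, - e <= f x) ->
  0 < f a.
Proof.
move=> fdf df0 fge0.
have dec x y : a <= x -> x < y -> f y < f x.
  move=> ax xy; rewrite -ltrN2.
  apply: (@is_derive_gt0_lt R (fun z => - f z) (fun z => - df z)) => //.
    move=> z /andP[xz _].
    by apply: (@is_deriveN _ _ _ f); apply: fdf; apply: le_trans xz.
  by move=> z /andP[xz _]; rewrite oppr_gt0 df0// (le_lt_trans ax).
apply: (@le_lt_trans _ _ (f (a + 1))); last by apply: dec => //; rewrite ltrDl.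
apply/ler_addgt0Pl => e e0.
have [x [xa fx]] : exists x, a + 1 < x /\ - e <= f x.
  near (+oo : set_system R) => x; exists x; split; near: x; last exact: fge0.
  by apply: nbhs_pinfty_gt; rewrite num_real.
have := dec (a + 1) x; rewrite lerDl ler01 => /(_ isT xa); lra.
Unshelve. all: by end_near. Qed.

Lemma is_derive1V (R : realType) (f : R -> R) (x df : R) : f x != 0 ->
  is_derive x 1 f df ->
  is_derive x 1 (fun y => (f y)^-1) (- df / f x ^+ 2).
Proof.
move=> fx0 fdf; apply: DeriveDef; first exact: derivableV.
by rewrite deriveV// derive_val /GRing.scale/= mulrC mulrN mulNr.
Qed.

(** * The standard normal density and tail *)

Lemma is_derive_std_normal_pdf (R : realType) (x : R) :
  is_derive x 1 (@std_normal_pdf R) (- x * std_normal_pdf x).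
Proof.
rewrite std_normal_pdfE.
rewrite (_ : @std_normal_pdf R =
  fun x => (Num.sqrt (2 * pi))^-1 * expR (- (x ^+ 2 / 2))); last first.
  by apply/funext => y; rewrite std_normal_pdfE.
apply: is_derive_eq.
rewrite !scaler1 /GRing.scale/=.
by field; rewrite sqrtr_eq0 -ltNge mulr_gt0 ?pi_gt0.
Qed.

(** The fundamental theorem of calculus needs integrability on some half-line
that reaches beyond x, here up to x + 1. *)
Lemma is_derive_std_normal_cdf (R : realType) (x : R) :
  is_derive x 1 (@std_normal_cdf R) (std_normal_pdf x).
Proof.
have intf : lebesgue_measure.-integrable `]-oo, x + 1]
    (EFin \o @std_normal_pdf R).
  apply: (integrableS measurableT) => //.
  exact: integrable_normal_pdf.
have xx1 : x < x + 1 by rewrite ltrDl.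
have cx : {for x, continuous (@std_normal_pdf R)}.
  by apply: continuous_normal_pdf; rewrite oner_neq0.
have [] := continuous_FTC1 xx1 intf (ltNyr _) cx.
move=> dF F'; split => //.
by rewrite -derive1E.
Qed.

(** The normal distribution function is the one of the identity random variable
under the normal probability, for which the limit at infinity is known. *)
Lemma cvgy_std_normal_cdf (R : realType) :
  @std_normal_cdf R x @[x --> +oo] --> (1 : R).
Proof.
(* The identity, with the measurable structure that random variables carry. *)
pose X : {RV (normal_prob (0 : R) 1) >-> R} :=
  HB.pack (idfun : measurableTypeR R -> R)
    (@isMeasurableFun.Build _ _ (measurableTypeR R) R
       (idfun : measurableTypeR R -> R) (@measurable_id _ _ setT)).
have := cvg_cdfy1 X.
move=> /fine_cvgP[_].
apply: cvg_trans; apply: near_eq_cvg; near=> x.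
rewrite /cdf /= /distribution /pushforward/= preimage_id.
by rewrite -EFin_std_normal_cdf.
Unshelve. all: by end_near. Qed.

Lemma std_normal_pdf_gt0 (R : realType) (x : R) : 0 < std_normal_pdf x.
Proof.
rewrite std_normal_pdfE mulr_gt0 ?expR_gt0// invr_gt0 sqrtr_gt0.
by rewrite mulr_gt0 ?pi_gt0.
Qed.

Lemma std_normal_pdf_le1 (R : realType) (x : R) : std_normal_pdf x <= 1.
Proof.
rewrite std_normal_pdfE -[leRHS]mulr1 ler_pM ?expR_ge0//.
- rewrite invf_le1 ?sqrtr_gt0 ?mulr_gt0 ?pi_gt0//.
  rewrite -[leLHS]sqrtr1 ler_wsqrtr//.
  by have := pi_ge2 R; lra.
- by rewrite -expR0 ler_expR oppr_le0 divr_ge0 ?sqr_ge0.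
Qed.

Definition normal_tail (R : realType) (x : R) := 1 - std_normal_cdf x.

Lemma is_derive_normal_tail (R : realType) (x : R) :
  is_derive x 1 (@normal_tail R) (- std_normal_pdf x).
Proof.
have ? := is_derive_std_normal_cdf x.
by rewrite /normal_tail; apply: is_derive_eq; rewrite add0r mul1r.
Qed.

Lemma normal_tail_small (R : realType) (e : R) : 0 < e ->
  \forall x \near +oo, normal_tail x <= e /\ - e <= normal_tail x.
Proof.
move=> e0; have /cvgrPdist_le/(_ _ e0) := @cvgy_std_normal_cdf R.
by apply: filterS => x; rewrite ler_norml => /andP[]; rewrite /normal_tail.
Qed.

(** The difference phi x / x - Q x tends to 0 at infinity and has the negative
derivative - phi x / x^2. *)
Lemma normal_tail_lt (R : realType) (x : R) : 0 < x ->
  normal_tail x < std_normal_pdf x / x.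
Proof.
move=> x0; rewrite -subr_gt0.
pose f (y : R) := std_normal_pdf y * y^-1 - normal_tail y.
apply: (@decreasing_to_ge0_gt0 R f (fun y => - (std_normal_pdf y / y ^+ 2))).
- move=> y xy; have y0 : y != 0 by rewrite gt_eqF// (lt_le_trans x0).
  have ? := is_derive_std_normal_pdf y.
  have ? := is_derive_normal_tail y.
  have ? := is_derive1V y0 (is_derive_id y 1).
  rewrite /f; apply: is_derive_eq.
  rewrite /GRing.scale/= ?mulr1.
  by field.
- move=> y xy; rewrite oppr_lt0 divr_gt0 ?std_normal_pdf_gt0// exprn_gt0//.
  exact: lt_trans xy.
- move=> e e0; near=> y.
  have y0 : 0 < y by near: y; apply: nbhs_pinfty_gt; rewrite num_real.
  have : normal_tail y <= e.
    by near: y; apply: filterS (normal_tail_small e0) => ? [].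
  have : 0 < std_normal_pdf y * y^-1 by rewrite divr_gt0 ?std_normal_pdf_gt0.
  by rewrite /f; lra.
Unshelve. all: by end_near. Qed.

(** The difference Q x - x phi x / (1 + x^2) tends to 0 at infinity and has the
negative derivative - 2 phi x / (1 + x^2)^2. *)
Lemma normal_tail_gt (R : realType) (x : R) :
  std_normal_pdf x * (x / (1 + x ^+ 2)) < normal_tail x.
Proof.
have p (y : R) : 0 < 1 + y ^+ 2 by rewrite ltr_pwDl ?sqr_ge0.
rewrite -subr_gt0.
pose f (y : R) := normal_tail y - std_normal_pdf y * (y * (1 + y ^+ 2)^-1).
apply: (@decreasing_to_ge0_gt0 R f
  (fun y => - (2 * std_normal_pdf y / (1 + y ^+ 2) ^+ 2))).
- move=> y xy; have y0 : 1 + y ^+ 2 != 0 by rewrite gt_eqF.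
  have ? := is_derive_std_normal_pdf y.
  have ? := is_derive_normal_tail y.
  have dp : is_derive y 1 (fun z : R => 1 + z ^+ 2) (2 * y).
    by apply: is_derive_eq; rewrite /GRing.scale/= add0r; ring.
  have ? := @is_derive1V _ (fun z => 1 + z ^+ 2) _ _ y0 dp.
  rewrite /f; apply: is_derive_eq.
  rewrite /GRing.scale/= ?mulr1.
  by field.
- move=> y xy; rewrite oppr_lt0 divr_gt0 ?exprn_gt0//.
  by rewrite mulr_gt0 ?std_normal_pdf_gt0.
- move=> e e0; have e20 : 0 < e / 2 by rewrite divr_gt0.
  near=> y.
  have y0 : 2 / e < y by near: y; apply: nbhs_pinfty_gt; rewrite num_real.
  have : - (e / 2) <= normal_tail y.
    by near: y; apply: filterS (normal_tail_small e20) => ? [].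
  suff : std_normal_pdf y * (y * (1 + y ^+ 2)^-1) <= e / 2 by rewrite /f; lra.
  have y1 : 0 < y by apply: lt_trans y0; rewrite divr_gt0.
  rewrite -[leRHS]mul1r ler_pM ?std_normal_pdf_le1 ?ltW ?std_normal_pdf_gt0//.
    by rewrite divr_gt0.
  rewrite ltr_pdivrMr//.
  move: y0; rewrite ltr_pdivrMr// => y0.
  have : 0 <= e / 2 by rewrite ltW.
  nra.
Unshelve. all: by end_near. Qed.

(** * Numerical facts on e and pi *)

(** Integrating 1 / (1 + x^2) <= 1 - x^2 / 2 over [0, 1] bounds
pi / 4 = atan 1 by 5/6. *)
Lemma pi_le (R : realType) : pi <= 10 / 3 :> R.
Proof.
suff : atan 1 <= 5 / 6 :> R by rewrite atan1; lra.
pose f (x : R) := x - x ^+ 3 / 6 - atan x.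
have : f 0 <= f 1.
  apply: (@is_derive_ge0_le R f
    (fun x => x ^+ 2 * (1 - x ^+ 2) / (2 * (1 + x ^+ 2)))) => //.
    move=> x _; have x0 : 1 + x ^+ 2 != 0 by rewrite gt_eqF// ltr_pwDl ?sqr_ge0.
    by rewrite /f; apply: is_derive_eq; rewrite /GRing.scale/= !mulr1; field.
  move=> x /andP[x0 x1].
  have x2 : x ^+ 2 <= 1 by rewrite expr_le1// ltW.
  have := sqr_ge0 x => ?.
  apply: divr_ge0; apply: mulr_ge0 => //; lra.
by rewrite /f atan0 expr1n expr0n/=; lra.
Qed.

(** The left number is the sum of the first six terms of the exponential
series at 1. *)
Lemma expR1_ge (R : realType) : 163 / 60 <= expR 1 :> R.
Proof.
rewrite (_ : 163 / 60 = series (exp_coeff (1 : R)) 6); last first.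
  rewrite /series/= !big_nat_recr//= big_nil /exp_coeff/= !expr1n.
  rewrite -[0`!]/1%N -[1`!]/1%N -[2`!]/2%N -[3`!]/6%N -[4`!]/24%N -[5`!]/120%N.
  lra.
apply: nondecreasing_cvgn_le; last exact: is_cvg_series_exp_coeff.
by apply: nondecreasing_series => i _ _; exact: exp_coeff_ge0.
Qed.

(** The two bounds give 6 pi <= 20 < (163/60)^3 <= e^3. *)
Lemma six_pi_lt_expR3 (R : realType) : 6 * pi < expR 3 :> R.
Proof.
have -> : expR 3 = expR 1 ^+ 3 :> R by rewrite -expRM_natl mulr1.
have := @pi_le R; have := @expR1_ge R; nra.
Qed.

(** Squaring removes the square root of 2 pi, so that comparisons of phi with
rational numbers become comparisons between powers of e and pi. *)
Lemma std_normal_pdf_sqr (R : realType) (x : R) :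
  std_normal_pdf x ^+ 2 = expR (- x ^+ 2) / (2 * pi).
Proof.
rewrite std_normal_pdfE exprMn exprVn sqr_sqrtr; last first.
  by rewrite mulr_ge0 ?pi_ge0.
by rewrite -expRM_natl mulrC; congr (expR _ / _); field.
Qed.

(** * Comparison with Chebyshev's bound below sqrt 3 *)

Definition pinelis_const (R : realType) : R := 2 * expR 3 / 9.

Lemma pinelis_const_gt0 (R : realType) : 0 < pinelis_const R.
Proof. by rewrite divr_gt0 ?mulr_gt0 ?expR_gt0. Qed.

(** After squaring, the claim is 81 pi <= 2 e^5, which follows from 6 pi < e^3
and e^2 >= 27/4. *)
Lemma pinelis_const_pdf1_ge1 (R : realType) :
  1 <= pinelis_const R * std_normal_pdf 1.
Proof.
rewrite -[leLHS](@expr1n _ 2) -(@ler_pXn2r _ 2)// ?nnegrE//; last first.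
  by rewrite mulr_ge0// ltW ?pinelis_const_gt0 ?std_normal_pdf_gt0.
rewrite expr1n exprMn std_normal_pdf_sqr expr1n /pinelis_const.
have e1 := expR1_ge R; move: (six_pi_lt_expR3 R) (pi_gt0 R).
move: (pi : R) => p e3 p0.
have e0 := expR_gt0 (1 : R).
have e13 : expR 3 = expR 1 ^+ 3 :> R by rewrite -expRM_natl mulr1.
have -> : (2 * expR 3 / 9) ^+ 2 * (expR (-1) / (2 * p)) =
    2 * expR 1 ^+ 2 * expR 3 / (81 * p) :> R.
  by rewrite expRN e13; field; rewrite !gt_eqF.
rewrite ler_pdivlMr ?mulr_gt0// mul1r.
have : 27 / 4 <= expR 1 ^+ 2 :> R by nra.
nra.
Qed.

(** By [normal_tail_gt], Q (sqrt 3) > phi (sqrt 3) * sqrt 3 / 4, and the square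
of c phi (sqrt 3) * sqrt 3 / 4 is e^3 / (216 pi), which exceeds 1/36 exactly
when e^3 > 6 pi. *)
Lemma pinelis_const_tail_sqrt3 (R : realType) :
  1 / 6 < pinelis_const R * normal_tail (Num.sqrt 3).
Proof.
have := normal_tail_gt (Num.sqrt 3 : R) => h.
rewrite -(ltr_pM2l (pinelis_const_gt0 R)) in h; apply: le_lt_trans h.
have s3 : Num.sqrt 3 ^+ 2 = 3 :> R by rewrite sqr_sqrtr.
rewrite s3 mulrA -(@ler_pXn2r _ 2)// ?nnegrE//; last first.
  by rewrite mulr_ge0 ?(ltW (pinelis_const_gt0 R))// divr_ge0// mulr_ge0
    ?sqrtr_ge0// ltW ?std_normal_pdf_gt0.
rewrite !exprMn std_normal_pdf_sqr s3 /pinelis_const.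
have e0 := expR_gt0 (3 : R); move: (six_pi_lt_expR3 R) (pi_gt0 R).
move: (pi : R) => p e3 p0.
rewrite [leRHS](_ : _ = expR 3 / (216 * p)); last first.
  by rewrite expRN; field; rewrite !gt_eqF.
rewrite ler_pdivlMr ?mulr_gt0//; lra.
Qed.

(** The function y^3 phi y has derivative y^2 (3 - y^2) phi y, so it increases
up to sqrt 3 and the value at 1 is decisive. *)
Lemma cube_mul_pdf_ge1 (R : realType) (x : R) : 1 <= x -> x ^+ 2 <= 3 ->
  1 <= pinelis_const R * std_normal_pdf x * x ^+ 3.
Proof.
move=> x1 x3.
apply: (le_trans (pinelis_const_pdf1_ge1 R)).
rewrite -mulrA ler_pM2l ?pinelis_const_gt0//.
pose f (y : R) := std_normal_pdf y * y ^+ 3.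
have <- : f 1 = std_normal_pdf 1 by rewrite /f expr1n mulr1.
apply: (@is_derive_ge0_le R f
  (fun y => y ^+ 2 * (3 - y ^+ 2) * std_normal_pdf y)) => //.
  move=> y _; have ? := is_derive_std_normal_pdf y.
  by rewrite /f; apply: is_derive_eq; rewrite /GRing.scale/=; ring.
move=> y /andP[y1 yx].
apply: mulr_ge0; last by rewrite ltW// std_normal_pdf_gt0.
apply: mulr_ge0; first exact: sqr_ge0.
by rewrite subr_ge0 (le_trans _ x3)// ler_pXn2r ?nnegrE//; lra.
Qed.

(** The derivative of 1 / (2 z^2) - c Q z is (c z^3 phi z - 1) / z^3, which is
nonnegative on [1, sqrt 3]; so this function is largest at sqrt 3, where it is
negative.  Below 1 the bound 1/2 is compared with c Q 1 instead. *)
Lemma min_half_chebyshev_lt (R : realType) (x p : R) : 0 < x -> x ^+ 2 <= 3 ->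
  p <= 1 / 2 -> p <= (2 * x ^+ 2)^-1 -> p < pinelis_const R * normal_tail x.
Proof.
have base y : 1 <= y -> y ^+ 2 <= 3 ->
    (2 * y ^+ 2)^-1 < pinelis_const R * normal_tail y.
  move=> y1 y3; rewrite -subr_gt0.
  pose f (z : R) := (2 * z ^+ 2)^-1 - pinelis_const R * normal_tail z.
  have s3 : Num.sqrt 3 ^+ 2 = 3 :> R by rewrite sqr_sqrtr.
  have ys : y <= Num.sqrt 3.
    by rewrite -(@ler_pXn2r _ 2)// ?nnegrE ?sqrtr_ge0 ?s3//; lra.
  suff : f y <= f (Num.sqrt 3).
    by have := pinelis_const_tail_sqrt3 R; rewrite /f s3; lra.
  apply: (@is_derive_ge0_le R f (fun z =>
    (pinelis_const R * std_normal_pdf z * z ^+ 3 - 1) / z ^+ 3)) => //.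
    move=> z /andP[yz zs]; have z0 : z != 0 by rewrite gt_eqF//; lra.
    have ? := is_derive_normal_tail z.
    have z20 : 2 * z ^+ 2 != 0 by rewrite mulf_neq0 ?expf_neq0.
    have dz : is_derive z 1 (fun z : R => 2 * z ^+ 2) (4 * z).
      by apply: is_derive_eq; rewrite /GRing.scale/=; ring.
    have ? := @is_derive1V _ (fun z => 2 * z ^+ 2) _ _ z20 dz.
    by rewrite /f; apply: is_derive_eq; rewrite /GRing.scale/=; field.
  move=> z /andP[yz zs].
  rewrite divr_ge0 ?exprn_ge0 ?subr_ge0//; last by lra.
  apply: cube_mul_pdf_ge1; first by lra.
  by rewrite -s3 ler_pXn2r ?nnegrE ?sqrtr_ge0//; lra.
move=> x0 x3 p1 p2; have [x1|x1] := leP 1 x.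
  exact: le_lt_trans p2 (base x x1 x3).
apply: (le_lt_trans p1).
have : pinelis_const R * normal_tail 1 <= pinelis_const R * normal_tail x.
  rewrite ler_pM2l ?pinelis_const_gt0// -lerN2.
  apply: (@is_derive_ge0_le R (fun z => - normal_tail z)
    (@std_normal_pdf R) _ _ (ltW x1)).
    move=> z _; have ? := is_derive_normal_tail z.
    by apply: is_derive_eq; rewrite opprK.
  by move=> z _; rewrite ltW ?std_normal_pdf_gt0.
apply: lt_le_trans; have := base 1; rewrite lexx expr1n => /(_ isT); lra.
Qed.

(** * Averaging the normal tail over one sign *)

(** In logarithmic form this reads y / (1 - y^2 / 3) <= artanh y.  The power
series make it plausible: the coefficients of y^(2k+1) are 1 / 3^k and
1 / (2k + 1).  The difference of the two sides has derivative a positive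
multiple of y^4 / ((1 - y^2) (3 - y^2)^2). *)
Lemma expR_artanh_le (R : realType) (y : R) : 0 <= y -> y < 1 ->
  expR (6 * y / (3 - y ^+ 2)) * (1 - y) <= 1 + y.
Proof.
move=> y0 y1.
pose f (z : R) := ln (1 + z) - ln (1 - z) - 6 * z * (3 - z ^+ 2)^-1.
suff : f 0 <= f y.
  rewrite /f addr0 subr0 mulr0 mul0r ln1 !subr0 => fy.
  rewrite -[leRHS]lnK ?posrE; last by lra.
  by rewrite -[X in _ * X]lnK ?posrE -?expRD ?ler_expR; lra.
apply: (@is_derive_ge0_le R f (fun z =>
  8 * z ^+ 4 / ((1 - z ^+ 2) * (3 - z ^+ 2) ^+ 2))) => //.
  move=> z /andP[z0 zy].
  have p1 : 0 < 1 + z by lra.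
  have p2 : 0 < 1 - z by lra.
  have p3 : 0 < 3 - z ^+ 2 by nra.
  have p3' : 3 - z ^+ 2 != 0 by rewrite gt_eqF.
  have ? := is_derive1_ln p1.
  have ? := is_derive1_ln p2.
  have dz : is_derive z 1 (fun z : R => 3 - z ^+ 2) (- 2 * z).
    by apply: is_derive_eq; rewrite /GRing.scale/=; ring.
  have ? := @is_derive1V _ (fun z => 3 - z ^+ 2) _ _ p3' dz.
  rewrite /f; apply: is_derive_eq; rewrite /GRing.scale/=.
  field.
  by rewrite p3' !gt_eqF//; nra.
move=> z /andP[z0 zy]; apply: divr_ge0.
  by rewrite mulr_ge0 ?exprn_ge0// ltW.
by apply: mulr_ge0; rewrite ?sqr_ge0//; nra.
Qed.

(** The quotient of the two densities is exp (2 y / s^2) with y = x t.  Since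
x^2 >= 3, one has y^2 >= 3 t^2, hence s^2 >= 1 - y^2 / 3 and
[expR_artanh_le] applies; for y >= 1 the left side is nonpositive. *)
Lemma pdf_shift_le (R : realType) (x s t : R) :
  3 <= x ^+ 2 -> 0 <= x -> 0 <= t -> 0 < s -> s ^+ 2 = 1 - t ^+ 2 ->
  std_normal_pdf ((x - t) / s) * (1 - x * t) <=
  std_normal_pdf ((x + t) / s) * (1 + x * t).
Proof.
move=> x3 x0 t0 s0 s2.
have y0 : 0 <= x * t by rewrite mulr_ge0.
have [y1|y1] := leP 1 (x * t).
  apply: (@le_trans _ _ 0).
    by rewrite mulr_ge0_le0 ?subr_le0// ltW ?std_normal_pdf_gt0.
  by rewrite mulr_ge0 ?ltW ?std_normal_pdf_gt0// ltr_wpDr.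
have -> : std_normal_pdf ((x - t) / s) =
    std_normal_pdf ((x + t) / s) * expR (2 * (x * t) / s ^+ 2).
  rewrite !std_normal_pdfE -[RHS]mulrA -expRD; congr (_ * expR _).
  by field; rewrite gt_eqF.
rewrite -mulrA ler_pM2l ?std_normal_pdf_gt0//.
apply: le_trans (expR_artanh_le y0 y1); rewrite ler_pM2r ?subr_gt0// ler_expR.
have s20 : 0 < s ^+ 2 by rewrite exprn_gt0.
have z2 : (x * t) ^+ 2 < 1 by rewrite expr_lt1.
rewrite ler_pdivrMr// mulrAC ler_pdivlMr; last by lra.
suff : 3 - (x * t) ^+ 2 <= 3 * s ^+ 2 by nra.
rewrite s2 exprMn; have := sqr_ge0 t; nra.
Qed.

(** There is equality at t = 0.  With t = sin z the arguments
(x -+ sin z) / cos z have the derivatives (x sin z -+ 1) / cos z^2, so that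
[pdf_shift_le] gives the sign of the derivative of the left side in z. *)
Lemma normal_tail_midpoint (R : realType) (x t : R) :
  0 <= x -> 3 <= x ^+ 2 -> `|t| < 1 ->
  normal_tail ((x - t) / Num.sqrt (1 - t ^+ 2)) +
  normal_tail ((x + t) / Num.sqrt (1 - t ^+ 2)) <= 2 * normal_tail x.
Proof.
move=> x0 x3.
wlog t0 : t / 0 <= t.
  move=> H t1; have [/H|/ltW t0] := leP 0 t; first exact.
  by have := H (- t); rewrite oppr_ge0 normrN sqrrN opprK addrC; apply.
rewrite ger0_norm// => t1.
have tN1 : -1 <= t <= 1 by lra.
rewrite -cos_asin//.
have a0 : 0 <= asin t.
  rewrite leNgt; apply/negP => an.
  have : sin (asin t) < 0.
    rewrite -oppr_gt0 -sinN sin_gt0_pihalf// oppr_gt0 an/= ltrNl.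
    by rewrite asin_gtNpi2//; lra.
  by rewrite asinK ?in_itv//=; lra.
have api : asin t < pi / 2 by rewrite asin_ltpi2//; lra.
have st : sin (asin t) = t by rewrite asinK ?in_itv.
move: (asin t) a0 api st => a a0 api <- {t t0 t1 tN1}.
pose f (z : R) := - (normal_tail ((x - sin z) * (cos z)^-1) +
  normal_tail ((x + sin z) * (cos z)^-1)).
rewrite -lerN2.
suff : f 0 <= f a by rewrite /f sin0 cos0 subr0 addr0 invr1 mulr1; lra.
apply: (@is_derive_ge0_le R f (fun z =>
  (std_normal_pdf ((x + sin z) / cos z) * (1 + x * sin z) -
   std_normal_pdf ((x - sin z) / cos z) * (1 - x * sin z)) / cos z ^+ 2)) => //.
  move=> z /andP[z0 za].
  have c0 : 0 < cos z by apply: cos_gt0_pihalf; have := pi_gt0 R; lra.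
  have c0' : cos z != 0 by rewrite gt_eqF.
  have ? := is_derive1V c0' (is_derive_cos z).
  have d1 := is_derive_normal_tail ((x - sin z) * (cos z)^-1).
  have d2 := is_derive_normal_tail ((x + sin z) * (cos z)^-1).
  have ? : is_derive z 1 (fun z : R => (x - sin z) * (cos z)^-1)
     ((x * sin z - (cos z ^+ 2 + sin z ^+ 2)) / cos z ^+ 2).
    by apply: is_derive_eq; rewrite /GRing.scale/=; field.
  have ? : is_derive z 1 (fun z : R => (x + sin z) * (cos z)^-1)
     ((x * sin z + (cos z ^+ 2 + sin z ^+ 2)) / cos z ^+ 2).
    by apply: is_derive_eq; rewrite /GRing.scale/=; field.
  rewrite /f; apply: is_derive_eq; rewrite /GRing.scale/= cos2Dsin2.
  by field.
move=> z /andP[z0 za].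
have c0 : 0 < cos z by apply: cos_gt0_pihalf; have := pi_gt0 R; lra.
rewrite divr_ge0 ?sqr_ge0// subr_ge0; apply: pdf_shift_le => //.
  by rewrite ltW// sin_gt0_pihalf// z0 (lt_trans za).
by rewrite cos2sin2.
Qed.

(** * Averages over all sign patterns *)

(** The average of f over all signed sums of the entries of s.  The recursion on
the first entry is the conditioning on the first sign that the induction
uses. *)
Fixpoint sign_mean (R : realType) (s : seq R) (f : R -> R) : R :=
  if s is a :: s' then
    (sign_mean s' (fun y => f (y + a)) + sign_mean s' (fun y => f (y - a))) / 2
  else f 0.

Lemma sign_mean_le (R : realType) (s : seq R) (f g : R -> R) :
  (forall y, f y <= g y) -> sign_mean s f <= sign_mean s g.
Proof.
elim: s f g => [|a s IH] f g fg /=; first exact: fg.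
by rewrite ler_pM2r ?invr_gt0// lerD// IH.
Qed.

Lemma eq_sign_mean (R : realType) (s : seq R) (f g : R -> R) :
  f =1 g -> sign_mean s f = sign_mean s g.
Proof. by move=> /funext ->. Qed.

Lemma sign_meanN (R : realType) (s : seq R) (f : R -> R) :
  sign_mean s (fun y => f (- y)) = sign_mean s f.
Proof.
elim: s f => [|a s IH] f /=; first by rewrite oppr0.
rewrite -(IH (fun y => f (y - a))) -(IH (fun y => f (y + a))) addrC.
by congr ((_ + _) / 2); apply: eq_sign_mean => y; congr f; ring.
Qed.

Lemma sign_meanD (R : realType) (s : seq R) (f g : R -> R) :
  sign_mean s (fun y => f y + g y) = sign_mean s f + sign_mean s g.
Proof. by elim: s f g => [//|a s IH] f g /=; rewrite !IH; field. Qed.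

Lemma sign_meanZ (R : realType) (s : seq R) (c : R) (f : R -> R) :
  sign_mean s (fun y => c * f y) = c * sign_mean s f.
Proof. by elim: s f => [//|a s IH] f /=; rewrite !IH; field. Qed.

Lemma sign_mean_cst (R : realType) (s : seq R) (c : R) :
  sign_mean s (fun=> c) = c.
Proof. by elim: s => [//|a s IH] /=; rewrite !IH; field. Qed.

(** The shift b makes the induction go through; at b = 0 this is the variance
of the signed sum. *)
Lemma sign_mean_sqr (R : realType) (s : seq R) (b : R) :
  sign_mean s (fun y => (y + b) ^+ 2) = b ^+ 2 + \sum_(a <- s) a ^+ 2.
Proof.
elim: s b => [|a s IH] b /=; first by rewrite add0r big_nil addr0.
under eq_sign_mean do rewrite -addrA.
under [X in _ + X]eq_sign_mean do rewrite -addrA.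
by rewrite !IH big_cons; field.
Qed.

Definition sign_tail (R : realType) (s : seq R) (t : R) :=
  sign_mean s (fun y => (t <= y)%R%:R).

Lemma sign_tail_cons (R : realType) (a t : R) (s : seq R) :
  sign_tail (a :: s) t = (sign_tail s (t - a) + sign_tail s (t + a)) / 2.
Proof.
by congr ((_ + _) / 2); apply: eq_sign_mean => y; rewrite ?lerBlDr ?lerBrDr.
Qed.

(** The signed sums are symmetric about 0, so twice the one-sided tail is the
two-sided one. *)
Lemma sign_tail_sym_le (R : realType) (s : seq R) (t : R) (f : R -> R) :
  (forall y, (t <= y)%R%:R + (t <= - y)%R%:R <= f y) ->
  2 * sign_tail s t <= sign_mean s f.
Proof.
move=> tf; rewrite (_ : 2 * _ =
  sign_mean s (fun y => (t <= y)%R%:R + (t <= - y)%R%:R)); last first.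
  rewrite sign_meanD (sign_meanN s (fun y => (t <= y)%R%:R)).
  by rewrite mulr_natl mulr2n.
exact: sign_mean_le.
Qed.

Lemma sign_tail_half (R : realType) (s : seq R) (t : R) : 0 < t ->
  sign_tail s t <= 1 / 2.
Proof.
move=> t0; suff : 2 * sign_tail s t <= sign_mean s (fun=> 1).
  by rewrite sign_mean_cst; lra.
apply: sign_tail_sym_le => y.
by have [|] := leP t y; have [|] := leP t (- y) => /=; lra.
Qed.

Lemma sign_tail_chebyshev (R : realType) (s : seq R) (t : R) : 0 < t ->
  sign_tail s t <= (\sum_(a <- s) a ^+ 2) / (2 * t ^+ 2).
Proof.
move=> t0.
suff : 2 * sign_tail s t <= sign_mean s (fun y => (t ^+ 2)^-1 * (y + 0) ^+ 2).
  rewrite sign_meanZ sign_mean_sqr expr0n/= add0r => h.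
  by rewrite invfM mulrCA ler_pdivlMl// [leRHS]mulrC.
apply: sign_tail_sym_le => y; rewrite addr0 ler_pdivlMl ?exprn_gt0//.
have := sqr_ge0 y.
by have [|] := leP t y; have [|] := leP t (- y) => /=; nra.
Qed.

(** The weights are not normalized, so the induction hypothesis applies to the
remaining weights without rescaling them.  When x^2 >= 3 with x = t / sqrt V,
one has t >= sqrt 3 * |a|, so both shifted thresholds t - a and t + a are
positive. *)
Lemma sign_tail_lt (R : realType) (s : seq R) (t : R) :
  0 < \sum_(a <- s) a ^+ 2 -> 0 < t ->
  sign_tail s t <
    pinelis_const R * normal_tail (t / Num.sqrt (\sum_(a <- s) a ^+ 2)).
Proof.
elim: s t => [|a s IH] t; first by rewrite big_nil ltxx.
set V := \sum_(b <- _ :: _) _ => V0 t0.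
have sV0 : 0 < Num.sqrt V by rewrite sqrtr_gt0.
have sV2 : Num.sqrt V ^+ 2 = V by rewrite sqr_sqrtr// ltW.
have x0 : 0 < t / Num.sqrt V by rewrite divr_gt0.
have [x3|/ltW x3] := leP ((t / Num.sqrt V) ^+ 2) 3.
  apply: min_half_chebyshev_lt => //; first exact: sign_tail_half.
  apply: le_trans (sign_tail_chebyshev _ t0) _.
  by rewrite expr_div_n sV2 [in leRHS]mulrA invf_div.
have VE : V = a ^+ 2 + \sum_(b <- s) b ^+ 2 by rewrite /V big_cons.
have W0 : 0 <= \sum_(b <- s) b ^+ 2 by apply: sumr_ge0 => b _; exact: sqr_ge0.
have t2 : 3 * V <= t ^+ 2.
  by move: x3; rewrite expr_div_n sV2 ler_pdivlMr.
have [ta Nta] : 0 < t - a /\ 0 < t + a by split; nra.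
rewrite sign_tail_cons.
(* All remaining weights vanish: Chebyshev's bound is 0. *)
have [W|Wn] := eqVneq (\sum_(b <- s) b ^+ 2) 0.
  have := sign_tail_chebyshev s ta; have := sign_tail_chebyshev s Nta.
  rewrite W !mul0r => h1 h2.
  have : 0 < pinelis_const R * normal_tail (t / Num.sqrt V).
    rewrite mulr_gt0 ?pinelis_const_gt0//.
    apply: le_lt_trans (normal_tail_gt _).
    rewrite mulr_ge0 ?(ltW (std_normal_pdf_gt0 _))// divr_ge0 ?(ltW x0)//.
    by rewrite addr_ge0 ?sqr_ge0.
  lra.
have {Wn}W0 : 0 < \sum_(b <- s) b ^+ 2 by rewrite lt_neqAle eq_sym Wn.
have a2 : a ^+ 2 < V by lra.
have tau1 : `|a / Num.sqrt V| < 1.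
  by rewrite -(@expr_lt1 _ 2)// -normrX ger0_norm ?sqr_ge0// expr_div_n sV2
    ltr_pdivrMr ?mul1r.
have := normal_tail_midpoint (ltW x0) x3 tau1.
have sE : Num.sqrt (1 - (a / Num.sqrt V) ^+ 2) =
    Num.sqrt (\sum_(b <- s) b ^+ 2) / Num.sqrt V.
  rewrite expr_div_n sV2 -sqrtrV ?ltW// -sqrtrM ?ltW//; congr Num.sqrt.
  by rewrite VE; field; rewrite -VE gt_eqF.
have sW0 : 0 < Num.sqrt (\sum_(b <- s) b ^+ 2) by rewrite sqrtr_gt0.
have cancel_sV b :
    b / Num.sqrt V / (Num.sqrt (\sum_(c <- s) c ^+ 2) / Num.sqrt V) =
    b / Num.sqrt (\sum_(c <- s) c ^+ 2).
  by field; rewrite !gt_eqF.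
rewrite sE -mulrDl -mulrBl !cancel_sV => mid.
rewrite -(ler_pM2l (pinelis_const_gt0 R)) in mid.
have := IH _ W0 ta; have := IH _ W0 Nta; lra.
Qed.

(** * From independent signs to averages over sign patterns *)

Lemma rademacher_ae d (T : measurableType d) (R : realType)
    (P : probability T R) (X : {RV P >-> R}) : rademacher X ->
  P (~` (X @^-1` [set 1] `|` X @^-1` [set -1])) = 0%E.
Proof.
move=> [P1 PN1].
have m c : measurable (X @^-1` [set c]) by exact: measurable_funPTI.
rewrite probability_setC; last exact: measurableU.
rewrite measureU//; last first.
  by apply/seteqP; split => // w [/= -> /eqP]; rewrite -subr_eq0 opprK gt_eqF.
transitivity (1 - ((2^-1)%:E + (2^-1)%:E) : \bar R)%E.
  by congr (1 - (_ + _))%E; [exact: P1|exact: PN1].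
change ((1 - (2^-1 + 2^-1))%:E = 0%:E :> \bar R).
by congr EFin; field.
Qed.

(** The event that the signs with index outside r have been revealed and follow
the pattern sgn, while those with index in r are still free. *)
Definition frozen_signs d (T : measurableType d) (R : realType)
    (P : probability T R) (n : nat) (eps : 'I_n -> {RV P >-> R})
    (r : seq 'I_n) (sgn : 'I_n -> R) : set T :=
  \bigcap_(i in [set` [set i | i \notin r]%SET]) (eps i @^-1` [set sgn i]).

Lemma prob_frozen_signs d (T : measurableType d) (R : realType)
    (P : probability T R) (n : nat) (eps : 'I_n -> {RV P >-> R})
    (r : seq 'I_n) (sgn : 'I_n -> R) :
  mutually_independent eps -> (forall i : 'I_n, rademacher (eps i)) ->
  (forall i, sgn i = 1 \/ sgn i = -1) ->
  P (frozen_signs eps r sgn) = (2^-1 ^+ #|[set i | i \notin r]%SET|)%:E.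
Proof.
move=> hindep heps sgn1; pose J := [set i | i \notin r]%SET.
have -> : P (frozen_signs eps r sgn) =
    (\prod_(i in J) P (eps i @^-1` [set sgn i]))%E.
  exact: (hindep J (fun i => [set sgn i]) (fun i _ => measurable_set1 (sgn i))).
rewrite (eq_bigr (fun=> (2^-1)%:E)); first by rewrite prodEFin prodr_const.
by move=> i _; have [h1 hN1] := heps i; case: (sgn1 i) => ->.
Qed.

Lemma measurable_frozen_signs d (T : measurableType d) (R : realType)
    (P : probability T R) (n : nat) (eps : 'I_n -> {RV P >-> R})
    (r : seq 'I_n) (sgn : 'I_n -> R) :
  measurable (frozen_signs eps r sgn).
Proof.
apply: fin_bigcap_measurable; first exact: finite_finset.
by move=> i _; exact: measurable_funPTI.
Qed.

Definition signed_sum_tail d (T : measurableType d) (R : realType)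
    (P : probability T R) (n : nat) (x : 'I_n -> R) (eps : 'I_n -> {RV P >-> R})
    (t : R) : set T :=
  [set w | t <= \sum_(i < n) eps i w * x i].

Lemma measurable_signed_sum_tail d (T : measurableType d) (R : realType)
    (P : probability T R) (n : nat) (x : 'I_n -> R) (eps : 'I_n -> {RV P >-> R})
    (t : R) :
  measurable (signed_sum_tail x eps t).
Proof.
rewrite (_ : signed_sum_tail x eps t =
    (fun w => \sum_(i < n) eps i w * x i) @^-1` `[t, +oo[).
  rewrite -[X in measurable X]setTI; apply: measurable_sum => // i.
  exact: measurable_funM.
by apply/seteqP; split => w /=; rewrite in_itv/= andbT.
Qed.

(** Induction on the list of free signs.  Revealing the sign i splits the event,
up to a null set, into the two events where it is 1 and -1; each has one more
frozen sign, which accounts for the factor 1/2, and a threshold shifted by the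
weight of i. *)
Lemma prob_frozen_signs_tail d (T : measurableType d) (R : realType)
    (P : probability T R) (n : nat) (x : 'I_n -> R) (eps : 'I_n -> {RV P >-> R})
    (r : seq 'I_n) (sgn : 'I_n -> R) (t : R) :
  mutually_independent eps -> (forall i : 'I_n, rademacher (eps i)) ->
  uniq r -> (forall i, sgn i = 1 \/ sgn i = -1) ->
  (P (frozen_signs eps r sgn `&` signed_sum_tail x eps t) <=
    (2^-1 ^+ #|[set i | i \notin r]%SET| *
     sign_tail (map x r) (t - \sum_(i | i \notin r) sgn i * x i))%:E)%E.
Proof.
move=> hindep heps; elim: r sgn => [|i r IH] sgn.
  move=> _ sgn1; rewrite /sign_tail [sign_mean _ _]/=.
  have [tS|tS] := leP (t - _) 0; last first.
    rewrite (_ : _ `&` _ = set0) ?measure0 ?mulr0//.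
    apply/seteqP; split => // w [/= fw]; apply/negP.
    rewrite -ltNge -subr_gt0 (lt_le_trans tS)// lerB// ler_sum// => i _.
    by rewrite fw//= inE.
  rewrite mulr1 -(prob_frozen_signs [::] hindep heps sgn1) le_measure ?inE//.
    exact/measurableI/measurable_signed_sum_tail/measurable_frozen_signs.
  exact: measurable_frozen_signs.
rewrite cons_uniq => /andP[ir ur] sgn1.
pose upd (c : R) j := if j == i then c else sgn j.
have upd1 c : c = 1 \/ c = -1 -> forall j, upd c j = 1 \/ upd c j = -1.
  by move=> c1 j; rewrite /upd; case: ifP.
pose E r' sgn' := frozen_signs eps r' sgn' `&` signed_sum_tail x eps t.
have mE r' sgn' : measurable (E r' sgn').
  exact/measurableI/measurable_signed_sum_tail/measurable_frozen_signs.
pose N := ~` (eps i @^-1` [set 1] `|` eps i @^-1` [set -1]).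
have mN : measurable N.
  by apply: measurableC; apply: measurableU; exact: measurable_funPTI.
have sub : E (i :: r) sgn `<=` E r (upd 1) `|` E r (upd (-1)) `|` N.
  move=> w [fw Sw].
  have fw' c : eps i w = c -> frozen_signs eps r (upd c) w.
    move=> ec j /=; rewrite inE /upd => jr; case: eqP => [->//|/eqP ji].
    by apply: fw; rewrite /= !inE negb_or ji.
  have [e1|e1] := pselect (eps i w = 1).
    by left; left; split => //; exact: fw'.
  have [e2|e2] := pselect (eps i w = -1).
    by left; right; split => //; exact: fw'.
  by right => -[].
apply: (@le_trans _ _ (P (E r (upd 1) `|` E r (upd (-1)) `|` N))).
  apply: le_measure => //; rewrite inE; first exact: mE.
  by do 2 ?apply: measurableU.
apply: (le_trans (measureU2 _ _ _)) => //; first exact: measurableU.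
rewrite [X in (_ + X)%E](rademacher_ae (heps i)) adde0.
apply: (le_trans (measureU2 _ _ _)) => //.
apply: (le_trans (leeD (IH _ ur (upd1 1 (or_introl erefl)))
  (IH _ ur (upd1 (-1) (or_intror erefl))))).
have sumE c : \sum_(j | j \notin r) upd c j * x j =
    c * x i + \sum_(j | j \notin i :: r) sgn j * x j.
  rewrite (bigD1 i)//= /upd eqxx; congr +%R.
  apply: eq_big => j; first by rewrite inE negb_or andbC.
  by move=> /andP[_ /negbTE ->].
have cardE : #|[set j | j \notin r]%SET| = #|[set j | j \notin i :: r]%SET|.+1.
  rewrite (cardsD1 i) inE ir add1n; congr _.+1.
  by apply: eq_card => j; rewrite !inE negb_or.
rewrite !sumE cardE /= sign_tail_cons -EFinD lee_fin exprS.
rewrite !opprD !addrA !mulN1r !mul1r opprK.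
rewrite [_ - x i - _]addrAC [_ + x i - _]addrAC.
lra.
Qed.

Lemma prob_signed_sum_tail d (T : measurableType d) (R : realType)
    (P : probability T R) (n : nat) (x : 'I_n -> R) (eps : 'I_n -> {RV P >-> R})
    (t : R) :
  mutually_independent eps -> (forall i : 'I_n, rademacher (eps i)) ->
  (P (signed_sum_tail x eps t) <=
    (sign_tail [seq x i | i <- enum 'I_n] t)%:E)%E.
Proof.
move=> hindep heps.
have := @prob_frozen_signs_tail _ _ _ _ _ x _ (enum 'I_n) (fun=> 1) t
  hindep heps (enum_uniq _).
have -> : #|[set i | i \notin enum 'I_n]%SET| = 0%N.
  by apply: eq_card0 => i; rewrite !inE mem_enum.
rewrite big1; last by move=> i; rewrite mem_enum.
rewrite expr0 mul1r subr0 => /(_ (fun=> or_introl erefl)).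
rewrite (_ : frozen_signs _ _ _ = setT) ?setTI//.
by apply/seteqP; split => // w _ i; rewrite /= inE mem_enum.
Qed.

Theorem mainTheorem8 (R : realType) (d : measure_display)
    (T : measurableType d) (P : probability T R)
    (n : nat) (x : 'I_n -> R) (eps : 'I_n -> {RV P >-> R})
    (hx : \sum_(i < n) x i ^+ 2 = 1)
    (hindep : mutually_independent eps)
    (heps : forall i : 'I_n, rademacher (eps i)) :
  forall t : R, 0 < t ->
    (P [set w | (t <= \sum_(i < n) eps i w * x i)%R] <
       (2 * expR 3 / 9 * (1 - std_normal_cdf t))%:E)%E /\
    2 * expR 3 / 9 * (1 - std_normal_cdf t) <
       2 * expR 3 / 9 * (std_normal_pdf t / t).
Proof.
move=> t t0; split.
  apply: (le_lt_trans (prob_signed_sum_tail x t hindep heps)).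
  have s1 : \sum_(a <- [seq x i | i <- enum 'I_n]) a ^+ 2 = 1.
    by rewrite big_map big_enum.
  have := @sign_tail_lt R [seq x i | i <- enum 'I_n] t.
  by rewrite s1 sqrtr1 divr1 lte_fin; exact.
by rewrite ltr_pM2l ?pinelis_const_gt0//; exact: normal_tail_lt.
Qed.
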